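(* Let $\beta>-1$ be a fixed real number. The basis functions $\tau_i,\rho_i$, $i=1,2,3$, of $\mathbb{P}_2(T)$ associated to the finite element $\mathcal{E}_\beta$ have the following expressions: for $i=1,2,3$, $$\tau_i=r_\beta\varphi_i+m_\beta\sum_{\substack{k=1\\k\neq i}}^{3}\varphi_k+\phi_i,\qquad \rho_i=\frac{1}{\nu_\beta L_\beta}\left((\sigma_\beta-2)\varphi_i-\sigma_\beta\sum_{\substack{k=1\\k\neq i}}^{3}\varphi_k\right),$$ where $$r_\beta=\frac{6(7\beta^2+18\beta+12)}{L_\beta},\qquad m_\beta=\frac{6(\beta^2+6\beta+6)}{L_\beta},\qquad L_\beta=18(\beta+1)(\beta+2).$$
   Context: Let $T\subset\mathbb{R}^2$ be a nondegenerate triangle with vertices $\boldsymbol{v}_1,\boldsymbol{v}_2,\boldsymbol{v}_3$, with the convention $\boldsymbol{v}_4=\boldsymbol{v}_1$, $\boldsymbol{v}_5=\boldsymbol{v}_2$; let $\boldsymbol{m}^\star=\frac{\boldsymbol{v}_1+\boldsymbol{v}_2+\boldsymbol{v}_3}{3}$, and let $\lambda_i$ be the barycentric coordinate associated to $\boldsymbol{v}_i$ (the affine function with $\lambda_i(\boldsymbol{v}_j)=\delta_{ij}$). Let $\mathbb{P}_2(T)$ be the space of real bivariate polynomials of total degree at most $2$, regarded as functions on $T$. For $j=1,2,3$ define $$\mathcal{I}^{\mathrm{CR}}_j(f)=\int_0^1 f\left(t\boldsymbol{v}_{j+1}+(1-t)\boldsymbol{v}_{j+2}\right)dt,\qquad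 \mathcal{G}^{\mathrm{enr}}_{j,\beta}(f)=\int_0^1 w_\beta(t)\, f\left(t\boldsymbol{v}_j+(1-t)\boldsymbol{m}^\star\right)dt,\qquad w_\beta(t)=t^\beta(1-t)^\beta.$$ The triple $\mathcal{E}_\beta=(T,\mathbb{P}_2(T),\{\mathcal{I}^{\mathrm{CR}}_j,\mathcal{G}^{\mathrm{enr}}_{j,\beta}: j=1,2,3\})$ is a finite element (the six functionals are unisolvent on $\mathbb{P}_2(T)$). The basis functions of $\mathbb{P}_2(T)$ associated to $\mathcal{E}_\beta$ are the basis $\{\tau_i,\rho_i: i=1,2,3\}$ of $\mathbb{P}_2(T)$ satisfying, for $i,j=1,2,3$, $$\mathcal{I}^{\mathrm{CR}}_j(\tau_i)=\delta_{ij},\quad \mathcal{G}^{\mathrm{enr}}_{j,\beta}(\tau_i)=0,\qquad \mathcal{I}^{\mathrm{CR}}_j(\rho_i)=0,\quad \mathcal{G}^{\mathrm{enr}}_{j,\beta}(\rho_i)=\delta_{ij}.$$ Moreover, $$\varphi_1=\lambda_1(1-3\lambda_2-3\lambda_3),\quad \varphi_2=\lambda_2(1-3\lambda_1-3\lambda_3),\quad \varphi_3=\lambda_3(1-3\lambda_1-3\lambda_2),$$ $$\phi_1=6\lambda_2\lambda_3,\quad \phi_2=6\lambda_1\lambda_3,\quad \phi_3=6\lambda_1\lambda_2,$$ $$\nu_\beta=\frac{B(\beta+2,\beta+1)}{3(2\beta+3)},\qquad \sigma_\beta=3\beta+4,$$ where $B(z_1,z_2)=\int_0^1 u^{z_1-1}(1-u)^{z_2-1}du$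 is the Euler beta function. *)

(* Defs.v *)
From HB Require Import structures.
From mathcomp Require Import all_boot all_order all_algebra.
From mathcomp Require Import all_classical all_reals all_analysis.
From mathcomp Require mpoly.
Import (canonicals, coercions) mpoly.

Set Implicit Arguments.
Unset Strict Implicit.
Unset Printing Implicit Defensive.

Import Order.TTheory GRing.Theory Num.Theory.
Import numFieldNormedType.Exports.

Local Open Scope classical_set_scope.
Local Open Scope ring_scope.

(* The indices 1, 2, 3 of the vertices are the elements 0, 1, 2 of 'I_3, whose
   addition is modulo 3: this is the convention v_4 = v_1, v_5 = v_2. *)

Definition nondegenerate_triangle (R : realType) (v : 'I_3 -> 'rV[R]_2) : bool :=
  free [:: v 1 - v 0; v 2%:R - v 0].

Definition triangle (R : realType) (v : 'I_3 -> 'rV[R]_2) : set 'rV[R]_2 :=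
  [set x | exists a : 'I_3 -> R,
     [/\ forall i, 0 <= a i, \sum_i a i = 1 & x = \sum_i a i *: v i]].

Definition mstar (R : realType) (v : 'I_3 -> 'rV[R]_2) : 'rV[R]_2 :=
  3%:R^-1 *: \sum_i v i.

Definition affine_function (R : realType) (f : 'rV[R]_2 -> R) : Prop :=
  exists (l : {scalar 'rV[R]_2}) (c : R), forall x, f x = l x + c.

Definition barycentric (R : realType) (v : 'I_3 -> 'rV[R]_2)
    (lam : 'I_3 -> 'rV[R]_2 -> R) : Prop :=
  forall i, affine_function (lam i) /\ forall j, lam i (v j) = (i == j)%:R.

(* Functions on a set K are represented by functions on the whole plane, of
   which only the values on K matter. [mpoly.msize p] is 1 + the total degree
   of p (and 0 for p = 0). *)
Definition poly2_on (R : realType) (K : set 'rV[R]_2) :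
    set ('rV[R]_2 -> R) :=
  [set f | exists2 p : mpoly.mpoly 2 R, (mpoly.msize p <= 3)%N &
     forall x, K x -> f x = mpoly.meval (fun i => x 0 i) p].

Definition ICR (R : realType) (v : 'I_3 -> 'rV[R]_2) (j : 'I_3)
    (f : 'rV[R]_2 -> R) : R :=
  \int[lebesgue_measure]_(t in `[0%R, 1%R])
    f (t *: v (j + 1) + (1 - t) *: v (j + 2%:R)).

Definition weight (R : realType) (beta t : R) : R :=
  t `^ beta * (1 - t) `^ beta.

Definition Genr (R : realType) (v : 'I_3 -> 'rV[R]_2) (beta : R) (j : 'I_3)
    (f : 'rV[R]_2 -> R) : R :=
  \int[lebesgue_measure]_(t in `[0%R, 1%R])
    (weight beta t * f (t *: v j + (1 - t) *: mstar v)).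

Record element (R : realType) := Element {
  el_domain : set 'rV[R]_2;
  el_space : set ('rV[R]_2 -> R);
  el_index : finType;
  el_dof : el_index -> ('rV[R]_2 -> R) -> R }.

Definition is_basis_on (R : realType) (K : set 'rV[R]_2)
    (P : set ('rV[R]_2 -> R)) (I : finType) (b : I -> 'rV[R]_2 -> R) : Prop :=
  [/\ forall i, P (b i),
      forall c : I -> R,
        (forall x, K x -> \sum_i c i * b i x = 0) -> forall i, c i = 0
    & forall f, P f ->
        exists c : I -> R, forall x, K x -> f x = \sum_i c i * b i x].

Definition basis_functions (R : realType) (E : element R)
    (b : el_index E -> 'rV[R]_2 -> R) : Prop :=
  is_basis_on (el_domain E) (el_space E) b /\
  forall i j : el_index E, el_dof j (b i) = (i == j)%:R.

Definition enriched_dof (R : realType) (v : 'I_3 -> 'rV[R]_2) (beta : R)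
    (s : ('I_3 + 'I_3)%type) : ('rV[R]_2 -> R) -> R :=
  match s with inl j => ICR v j | inr j => Genr v beta j end.

Definition enriched_element (R : realType) (v : 'I_3 -> 'rV[R]_2) (beta : R) :
    element R :=
  Element (triangle v) (poly2_on (triangle v)) (enriched_dof v beta).

Definition pair_family (R : realType) (tau rho : 'I_3 -> 'rV[R]_2 -> R)
    (s : ('I_3 + 'I_3)%type) : 'rV[R]_2 -> R :=
  match s with inl i => tau i | inr i => rho i end.

Definition varphi (R : realType) (lam : 'I_3 -> 'rV[R]_2 -> R) (i : 'I_3)
    (x : 'rV[R]_2) : R :=
  lam i x * (1 - 3%:R * lam (i + 1) x - 3%:R * lam (i + 2%:R) x).

Definition phi (R : realType) (lam : 'I_3 -> 'rV[R]_2 -> R) (i : 'I_3)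
    (x : 'rV[R]_2) : R :=
  6%:R * lam (i + 1) x * lam (i + 2%:R) x.

(* The library's [beta_fun] only takes natural arguments. *)
Definition euler_beta (R : realType) (z1 z2 : R) : R :=
  \int[lebesgue_measure]_(u in `[0%R, 1%R])
    (u `^ (z1 - 1) * (1 - u) `^ (z2 - 1)).

Definition nu (R : realType) (beta : R) : R :=
  euler_beta (beta + 2%:R) (beta + 1) / (3%:R * (2%:R * beta + 3%:R)).

Definition sigma (R : realType) (beta : R) : R := 3%:R * beta + 4%:R.

Definition Lbeta (R : realType) (beta : R) : R :=
  18%:R * (beta + 1) * (beta + 2%:R).

Definition rbeta (R : realType) (beta : R) : R :=
  6%:R * (7%:R * beta ^+ 2 + 18%:R * beta + 12%:R) / Lbeta beta.

Definition mbeta (R : realType) (beta : R) : R :=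
  6%:R * (beta ^+ 2 + 6%:R * beta + 6%:R) / Lbeta beta.

(* Main.v *)
Require Import Defs.
From HB Require Import structures.
From mathcomp Require Import all_boot all_order all_algebra.
From mathcomp Require Import all_classical all_reals all_analysis.
From mathcomp Require Import measurable_realfun.
From mathcomp Require Import ring lra.
Import (canonicals, coercions) mpoly.
Import Order.TTheory GRing.Theory Num.Theory.
Import numFieldNormedType.Exports.
Local Open Scope classical_set_scope.
Local Open Scope ring_scope.

(* On T the functions varphi_i and phi_i span the polynomials of degree at most
   2. The Crouzeix-Raviart functionals vanish on every varphi_i and satisfy
   I_j(phi_i) = delta_ij; the enriched ones take the values 2 nu and -sigma nu
   on varphi_j and varphi_i (i <> j), and 2 (beta + 2) nu and (8 beta + 10) nu
   on phi_j and phi_i. The duality relations are then rational identities in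
   beta, and they identify any polynomial from its six degrees of freedom.
   The functionals only involve the moments of w_beta of order at most 2;
   integrating the derivatives of t^(beta+1) (1-t)^(beta+1) and of
   t^(beta+2) (1-t)^(beta+1) over [0, 1] expresses them all in terms of the
   moment of order 0. *)

Set Implicit Arguments.
Unset Strict Implicit.
Unset Printing Implicit Defensive.

(** * Improper fundamental theorem of calculus *)

(** [F] is tied to the endpoints by one-sided limits only, and nothing is asked of [f] there: the
    integrands to come may blow up at the ends. *)
Definition antiderivative_oo (R : realType) (a b : R) (F f : R -> R) : Prop :=
  [/\ {in `]a, b[, continuous f},
      {in `]a, b[, forall x : R, is_derive x (1 : R) F (f x)},
      F x @[x --> a^'+] --> F a & F x @[x --> b^'-] --> F b].

(** The open interval is exhausted by compact ones: the continuous theorem applies to each, the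
    integrals converge monotonically, and the right-hand sides converge by the one-sided limits of
    [F]. *)
Lemma ge0_FTC_oo (R : realType) (f F : R -> R) (a b : R) : a < b ->
    antiderivative_oo a b F f -> {in `]a, b[, forall x, 0 <= f x} ->
  (\int[lebesgue_measure]_(x in `]a, b[) (f x)%:E)%E = (F b - F a)%:E.
Proof.
move=> ab [cf dF Fa Fb] f0.
have dF1 x : x \in `]a, b[ -> derivable F x 1 by move=> /dF[].
have cF : {in `]a, b[, continuous F}.
  by move=> x /dF1/derivable1_diffP/differentiable_continuous.
(* The denominator [n + 3] gives [2 * d n < b - a] already for [n = 0], so no interval of the
   exhaustion is degenerate. *)
pose d n : R := (b - a) / n.+3%:R.
have d0 n : 0 < d n by rewrite divr_gt0// subr_gt0.
have d3 n : d n *+ 2 < b - a.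
  rewrite -mulr_natl mulrCA gtr_pMr ?subr_gt0// ltr_pdivrMr// mul1r ltr_nat.
  by rewrite !ltnS.
have dd n m : (n <= m)%N -> d m <= d n.
  move=> nm; rewrite ler_pM2l ?subr_gt0// lef_pV2 ?posrE// ler_nat.
  by rewrite !ltnS.
have dcvg : d n @[n --> \oo] --> (0 : R).
  rewrite -(mulr0 (b - a)); apply: cvgMr.
  have := @cvg_harmonic R; rewrite -(cvg_shiftn 2)/=.
  by under eq_fun do rewrite addn2.
have subI n : `[a + d n, b - d n] `<=` `]a, b[.
  move=> x /=; rewrite !in_itv/= => /andP[ax xb].
  rewrite (lt_le_trans _ ax) ?ltrDl//= (le_lt_trans xb)//.
  by rewrite ltrBlDr ltrDl.
have UI : `]a, b[%classic = \bigcup_n `[a + d n, b - d n]%classic.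
  apply/seteqP; split; last by move=> x [n _]; exact: subI.
  move=> x /=; rewrite in_itv/= => /andP[ax xb].
  have m0 : 0 < Num.min (x - a) (b - x).
    by rewrite lt_min !subr_gt0 ax xb.
  move/cvgrPdist_lt : dcvg => /(_ _ m0) [n _ /(_ n (leqnn _))] /=.
  rewrite sub0r normrN gtr0_norm// lt_min => /andP[h1 h2].
  by exists n => //=; rewrite in_itv/=; apply/andP; split; lra.
have FTC n : (\int[lebesgue_measure]_(x in `[(a + d n)%R, (b - d n)%R]) (f x)%:E)%E
    = (F (b - d n) - F (a + d n))%:E.
  have abn : a + d n < b - d n by have := d3 n; rewrite mulr2n; lra.
  rewrite (@continuous_FTC2 _ f F)//.
  - apply: continuous_in_subspaceT => x /set_mem/subI; exact: cf.
  - split.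
    + by move=> x /subset_itv_oo_cc /subI /dF1.
    + apply: cvg_at_right_filter; apply: cF; apply: (subI n).
      by rewrite /= in_itv/= ?lexx ?(ltW abn).
    + apply: cvg_at_left_filter; apply: cF; apply: (subI n).
      by rewrite /= in_itv/= ?lexx ?(ltW abn).
  - move=> x /subset_itv_oo_cc /subI xab; rewrite derive1E.
    by case: (dF x xab).
have mf : measurable_fun `]a, b[ f.
  by apply: open_continuous_measurable_fun => // x /set_mem; exact: cf.
have cvgI : (\int[lebesgue_measure]_(x in `[(a + d n)%R, (b - d n)%R])
    (f x)%:E)%E @[n --> \oo] --> (\int[lebesgue_measure]_(x in `]a, b[) (f x)%:E)%E.
  rewrite UI; apply: ge0_nondecreasing_set_cvg_integral => //.
  - move=> m n mn; apply/subsetPset => x /=; rewrite !in_itv/= => /andP[h1 h2].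
    by have := dd _ _ mn => h; apply/andP; split; lra.
  - by move=> n; apply/measurable_EFinP; apply: measurable_funS mf.
  - by move=> n x /subI xab; rewrite lee_fin; exact: f0.
rewrite -(cvg_lim _ cvgI)//; apply/cvg_lim => //.
under eq_cvg => n do rewrite FTC.
apply: cvg_EFin; first by near=> n.
apply: cvgB.
- apply: (cvg_at_leftP _ _ _).1 Fb _ _; split=> [n|].
    by rewrite ltrBlDr ltrDl.
  rewrite -[X in _ --> X]subr0; exact: cvgB (cvg_cst _) dcvg.
- apply: (cvg_at_rightP _ _ _).1 Fa _ _; split=> [n|].
    by rewrite ltrDl.
  rewrite -[X in _ --> X]addr0; exact: cvgD (cvg_cst _) dcvg.
Unshelve. all: by end_near. Qed.

Lemma antiderivative_ooD (R : realType) (a b : R) (F f G g : R -> R) :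
  antiderivative_oo a b F f -> antiderivative_oo a b G g ->
  antiderivative_oo a b (F \+ G) (f \+ g).
Proof.
move=> [cf dF Fa Fb] [cg dG Ga Gb]; split; [| |exact: cvgD..].
- by move=> x xab; apply: cvgD; [exact: cf|exact: cg].
- by move=> x xab; apply: is_deriveD; [exact: dF|exact: dG].
Qed.

Lemma antiderivative_ooN (R : realType) (a b : R) (F f : R -> R) :
  antiderivative_oo a b F f -> antiderivative_oo a b (\- F) (\- f).
Proof.
move=> [cf dF Fa Fb]; split; [| |exact: cvgN..].
- by move=> x xab; apply: cvgN; exact: cf.
- by move=> x xab; apply: is_deriveN; exact: dF.
Qed.

(** The endpoints form a null set, and inside [f] is its own absolute value, so the finite value of
    the integral also yields integrability. *)
Lemma ge0_FTC_cc (R : realType) (f F : R -> R) (a b : R) : a < b ->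
    antiderivative_oo a b F f -> {in `]a, b[, forall x, 0 <= f x} ->
  lebesgue_measure.-integrable `[a, b] (EFin \o f) /\
  \int[lebesgue_measure]_(x in `[a, b]) f x = F b - F a.
Proof.
move=> ab Ff f0; have [cf _ _ _] := Ff.
have mf : measurable_fun `]a, b[ f.
  by apply: open_continuous_measurable_fun => // x /set_mem; exact: cf.
have mEf : measurable_fun `]a, b[ (EFin \o f) by exact/measurable_EFinP.
have If := ge0_FTC_oo ab Ff f0.
have mcf : measurable_fun `[a, b] f.
  by apply/measurable_fun_itv_bndo_bndcP/measurable_fun_itv_obnd_cbndP.
have Icf : (\int[lebesgue_measure]_(x in `[a, b]) (f x)%:E)%E = (F b - F a)%:E.
  by rewrite integral_itv_bndoo.
split; last by rewrite /Rintegral Icf.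
apply/integrableP; split; first exact/measurable_EFinP.
rewrite integral_itv_bndoo; last exact: measurableT_comp.
rewrite (_ : (\int[_]_(_ in _) _)%E = (F b - F a)%:E) ?ltry// -If.
apply: eq_integral => x xab /=.
by rewrite ger0_norm// f0//; move/set_mem: xab.
Qed.

(* The integrable minorant - g makes f + g and g accessible to the nonnegative
   case; no integrability of f has to be known beforehand. *)
Lemma FTC_cc (R : realType) (f F g G : R -> R) (a b : R) : a < b ->
    antiderivative_oo a b F f -> antiderivative_oo a b G g ->
    {in `]a, b[, forall x, 0 <= g x} -> {in `]a, b[, forall x, 0 <= f x + g x} ->
  lebesgue_measure.-integrable `[a, b] (EFin \o f) /\
  \int[lebesgue_measure]_(x in `[a, b]) f x = F b - F a.
Proof.
move=> ab Ff Gg g0 fg0.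
have [ig Ig] := ge0_FTC_cc ab Gg g0.
have [ifg Ifg] := ge0_FTC_cc ab (antiderivative_ooD Ff Gg) fg0.
have fE : f = (f \+ g) \- g by apply/funext => x /=; rewrite addrK.
have fE' : EFin \o f = ((EFin \o (f \+ g)%R) \- (EFin \o g))%E.
  by apply/funext => x /=; rewrite -EFinB addrK.
split; first by rewrite fE'; exact: integrableB.
rewrite [in LHS]fE RintegralB// Ifg Ig/=; ring.
Qed.

(** * Moments of the weight *)

Definition powR_onem (R : realType) (p q t : R) : R := t `^ p * (1 - t) `^ q.

(** The case [p = 0] is separate: the power of 0 is then 1, whereas it is 0 for [p > 0]. *)
Lemma powR_cvg_at_right0 (R : realType) (p : R) : 0 <= p ->
  (t `^ p @[t --> (0 : R)^'+] --> (0 : R) `^ p).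
Proof.
rewrite le_eqVlt => /predU1P[<-|p0].
  by under eq_cvg => t do rewrite powRr0; rewrite powRr0; exact: cvg_cst.
by rewrite powR0 ?gt_eqF//; exact: powR_cvg0.
Qed.

Lemma powR_continuous (R : realType) (p x : R) : 0 < x ->
  {for x, continuous (fun t : R => t `^ p)}.
Proof.
move=> x0; apply/differentiable_continuous/derivable1_diffP.
by apply: derivable_powR; rewrite in_itv/= x0.
Qed.

Lemma onem_cvg (R : realType) (x : R) : (1 - t) @[t --> x] --> 1 - x.
Proof. by apply: cvgB; [exact: cvg_cst|exact: cvg_id]. Qed.

Lemma is_derive_powR_onem (R : realType) (p q x : R) : 0 < x < 1 ->
  is_derive x (1 : R) (powR_onem p q)
    (p * powR_onem (p - 1) q x - q * powR_onem p (q - 1) x).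
Proof.
move=> /andP[x0 x1].
have h1 : is_derive x (1 : R) (fun t : R => 1 - t) (-1).
  apply: (is_derive_eq (is_deriveB (is_derive_cst _ _ _) (is_derive_id _ _))).
  by rewrite sub0r.
have h2 : is_derive (1 - x) (1 : R) (fun t : R => t `^ q) (q * (1 - x) `^ (q - 1)).
  by apply: is_derive1_powR; rewrite subr_gt0.
have h3 := @is_derive1_comp R (fun t => t `^ q) (fun t => 1 - t) x _ _ h2 h1.
have h4 : is_derive x (1 : R) (fun t : R => t `^ p) (p * x `^ (p - 1)).
  exact: is_derive1_powR.
apply: (is_derive_eq (is_deriveM h4 h3)).
by rewrite /powR_onem /= /GRing.scale/=; ring.
Qed.

Lemma continuous_powR_onem (R : realType) (p q x : R) : 0 < x < 1 ->
  {for x, continuous (@powR_onem R p q)}.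
Proof.
move=> /is_derive_powR_onem-/(_ p q)[+ _].
by move/derivable1_diffP/differentiable_continuous.
Qed.

(** Exponent 0 is allowed in order to cover the pure powers of [t] and of [1 - t], which serve below
    as comparison functions. *)
Lemma antiderivative_powR_onem (R : realType) (p q : R) : 0 <= p -> 0 <= q ->
  antiderivative_oo 0 1 (powR_onem p q)
    (fun t => p * powR_onem (p - 1) q t - q * powR_onem p (q - 1) t).
Proof.
move=> p0 q0; split.
- move=> x; rewrite in_itv/= => x01.
  by apply: cvgB; apply: cvgMr; exact: continuous_powR_onem.
- by move=> x; rewrite in_itv/= => x01; exact: is_derive_powR_onem.
- apply: cvgM; first exact: powR_cvg_at_right0.
  apply: cvg_at_right_filter.
  apply: (@continuous_comp _ _ _ (fun t : R => 1 - t) (fun t : R => t `^ q)).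
    exact: onem_cvg.
  by apply: powR_continuous; rewrite subr0.
- apply: cvgM.
    by apply: cvg_at_left_filter; exact: powR_continuous.
  rewrite subrr.
  have := powR_cvg_at_right0 q0.
  (* The limit at 1 from the left is turned into a limit at 0 from the right. *)
  have : (1 - t @[t --> (1:R)^'-] --> (0:R)^'+).
    move=> A A0; have := @onem_cvg R 1; rewrite subrr => /(_ _ A0).
    rewrite /at_right /at_left /within/= => A1.
    have := A1; apply: (@filterS _ (nbhs (1 : R))) => t h t1.
    by apply: h; rewrite subr_gt0.
  exact: cvg_comp.
Qed.

(** Both boundary values vanish because the exponents are positive. The integrand changes sign and
    may be unbounded, hence the use of [FTC_cc]. *)
Lemma Rintegral_derive_powR_onem (R : realType) (p q : R) : 0 < p -> 0 < q ->
  \int[lebesgue_measure]_(t in `[0, 1])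
    (p * powR_onem (p - 1) q t - q * powR_onem p (q - 1) t) = 0.
Proof.
move=> p0 q0.
have H1 := antiderivative_powR_onem (ltW p0) (ltW q0).
(* the minorant is - q (1 - t)^(q - 1), with antiderivative (1 - t)^q *)
have H2 := antiderivative_ooN (antiderivative_powR_onem (lexx 0) (ltW q0)).
have [| | |_ ->] := FTC_cc _ H1 H2.
- exact: ltr01.
- move=> x _ /=; rewrite mul0r sub0r opprK mulr_ge0 ?(ltW q0)//.
  by rewrite mulr_ge0// powR_ge0.
- move=> x; rewrite in_itv/= => /andP[x0 x1].
  rewrite /= mul0r sub0r opprK -addrA addr_ge0//.
    by rewrite !mulr_ge0 ?powR_ge0// ltW.
  (* What remains is [q (1 - x)^(q - 1) (1 - x^p) >= 0], that is, [x^p <= x^0]. *)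
  rewrite addrC subr_ge0 ler_pM2l// /powR_onem powRr0.
  rewrite ler_wpM2r ?powR_ge0// -[leRHS](powRr0 x).
  by apply: ger_powR; rewrite ?x0 ltW.
by rewrite /powR_onem !subrr subr0 !powR0 ?gt_eqF// !(mul0r, mulr0) subrr.
Qed.

(** Domination by [t^p + (1 - t)^q]: up to a constant factor, each term is the derivative of a power
    of positive exponent, hence integrable by [ge0_FTC_cc]. *)
Lemma integrable_powR_onem (R : realType) (p q : R) : -1 < p -> -1 < q ->
  lebesgue_measure.-integrable `[0%R, 1%R] (EFin \o @powR_onem R p q).
Proof.
move=> p1 q1.
have p0 : 0 < p + 1 by lra.
have q0 : 0 < q + 1 by lra.
have [|ip _] := ge0_FTC_cc ltr01 (antiderivative_powR_onem (ltW p0) (lexx 0)).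
  move=> x _; rewrite mul0r subr0 mulr_ge0 ?(ltW p0)//.
  by rewrite mulr_ge0// powR_ge0.
have [|iq _] := ge0_FTC_cc ltr01 (antiderivative_ooN (antiderivative_powR_onem (lexx 0) (ltW q0))).
  move=> x _ /=; rewrite mul0r sub0r opprK mulr_ge0 ?(ltW q0)//.
  by rewrite mulr_ge0// powR_ge0.
have := integrableD _ (integrableZl _ (p + 1)^-1 ip) (integrableZl _ (q + 1)^-1 iq).
move=> /(_ (measurable_itv _) (measurable_itv _) (measurable_itv _)).
apply: le_integrable => //.
  apply/measurable_EFinP/measurable_funTS; apply: measurable_funM.
    exact: measurable_powR.
  apply: (measurableT_comp (measurable_powR _)).
  exact: measurable_funB.
move=> x; rewrite /= in_itv/= => /andP[x0 x1].
rewrite lee_fin.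
rewrite !addrK !mul0r !sub0r subr0 opprK !mulKf ?gt_eqF// /powR_onem !powRr0.
rewrite mul1r mulr1.
rewrite !ger0_norm ?addr_ge0 ?mulr_ge0 ?powR_ge0//.
have le1 (r y : R) : 0 < r + 1 -> 0 <= y <= 1 -> y * y `^ r <= 1.
  move=> r0 /andP[y0 y1]; have := mulr_powRB1 y0 r0; rewrite addrK => ->.
  have pow1 : 1 `^ (r + 1) = 1 :> R by rewrite powR1.
  rewrite -[leRHS]pow1.
  by apply: ge0_ler_powR; rewrite ?nnegrE// ltW.
have x1' : 0 <= 1 - x <= 1 by rewrite subr_ge0 x1 lerBlDr lerDl.
(* t^p (1 - t)^q <= t^p + (1 - t)^q: write 1 = t + (1 - t) on the left *)
rewrite -[leLHS]mul1r -[X in X * _](subrK x) mulrDl addrC.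
have -> : x * (x `^ p * (1 - x) `^ q) = (x * x `^ p) * (1 - x) `^ q by ring.
have -> : (1 - x) * (x `^ p * (1 - x) `^ q) = ((1 - x) * (1 - x) `^ q) * x `^ p.
  by ring.
rewrite [leRHS]addrC; apply: lerD; rewrite ler_piMl ?powR_ge0 ?le1 ?x0//.
Qed.

Definition moment (R : realType) (beta : R) (n : nat) : R :=
  \int[lebesgue_measure]_(t in `[0%R, 1%R]) (weight beta t * t ^+ n).

Lemma integrable_weightX (R : realType) (beta : R) n : -1 < beta ->
  lebesgue_measure.-integrable `[0%R, 1%R]
    (EFin \o (fun t : R => weight beta t * t ^+ n)).
Proof.
move=> b1; have := integrable_powR_onem b1 b1.
apply: le_integrable => //.
  apply/measurable_EFinP/measurable_funTS; apply: measurable_funM => //.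
  apply: measurable_funM; first exact: measurable_powR.
  apply: (measurableT_comp (measurable_powR _)).
  exact: measurable_funB.
move=> x; rewrite /= in_itv/= => /andP[x0 x1].
rewrite lee_fin normrM ler_piMr// ger0_norm ?exprn_ge0//.
exact: exprn_ile1.
Qed.

Lemma Rintegral_weight_quadratic (R : realType) (beta a b c : R) : -1 < beta ->
  \int[lebesgue_measure]_(t in `[0%R, 1%R])
    (weight beta t * (a + b * t + c * t ^+ 2)) =
  a * moment beta 0 + b * moment beta 1 + c * moment beta 2.
Proof.
move=> b1; have iw n := integrable_weightX n b1.
have iZ k n : lebesgue_measure.-integrable `[0%R, 1%R]
    (EFin \o (fun t : R => k * (weight beta t * t ^+ n))).
  by have := integrableZl _ k (iw n); exact.
rewrite -!RintegralZl// -!RintegralD//; last first.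
  by have := integrableD _ (iZ a 0) (iZ b 1); exact.
by apply: eq_Rintegral => t _; rewrite expr0 expr1; ring.
Qed.

(** The derivative of [t^(beta+1) (1 - t)^(beta+1)] is [(beta + 1) (1 - 2 t) w_beta(t)]. *)
Lemma moment1E (R : realType) (beta : R) : -1 < beta ->
  moment beta 1 = moment beta 0 / 2%:R.
Proof.
move=> b1; have b0 : 0 < beta + 1 by lra.
have : \int[lebesgue_measure]_(t in `[0%R, 1%R]) (weight beta t *
    ((beta + 1) + (- (beta + 1) *+ 2) * t + 0 * t ^+ 2)) = 0.
  rewrite -[RHS](Rintegral_derive_powR_onem b0 b0); apply: eq_Rintegral => t.
  rewrite inE/= in_itv/= => /andP[t0 t1].
  have t1' : 0 <= 1 - t by rewrite subr_ge0.
  (* Splitting one factor off a power stays valid at the endpoints, where the power of 0 has a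
     finite value whatever the sign of [beta]. *)
  rewrite /powR_onem /weight -(mulr_powRB1 t0 b0) -(mulr_powRB1 t1' b0) addrK.
  ring.
rewrite Rintegral_weight_quadratic// => h.
have : (beta + 1) * (moment beta 0 - moment beta 1 *+ 2) = 0.
  by rewrite -[RHS]h; ring.
by move/eqP; rewrite mulf_eq0 gt_eqF//= => /eqP; lra.
Qed.

(** The derivative of [t^(beta+2) (1 - t)^(beta+1)] is [((beta + 2) t - (2 beta + 3) t^2)
    w_beta(t)], which gives the ratio of the moments of orders 2 and 1. *)
Lemma moment2E (R : realType) (beta : R) : -1 < beta ->
  moment beta 2 =
  moment beta 0 * (beta + 2%:R) / (2%:R * (2%:R * beta + 3%:R)).
Proof.
move=> b1; have b0 : 0 < beta + 1 by lra.
have b2 : 0 < beta + 2%:R by lra.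
have : \int[lebesgue_measure]_(t in `[0%R, 1%R]) (weight beta t *
    (0 + (beta + 2) * t + (- (2 * beta + 3)) * t ^+ 2)) = 0.
  rewrite -[RHS](Rintegral_derive_powR_onem b2 b0); apply: eq_Rintegral => t.
  rewrite inE/= in_itv/= => /andP[t0 t1].
  have t1' : 0 <= 1 - t by rewrite subr_ge0.
  rewrite /powR_onem /weight -(mulr_powRB1 t0 b2) -(mulr_powRB1 t1' b0).
  rewrite (_ : beta + 2 - 1 = beta + 1); last by ring.
  rewrite -(mulr_powRB1 t0 b0) addrK.
  ring.
rewrite Rintegral_weight_quadratic// moment1E// => h.
have b3 : 2 * beta + 3 != 0 by apply/eqP; lra.
apply: (@mulfI _ (2 * beta + 3)) => //.
transitivity ((beta + 2) * (moment beta 0 / 2)); first by lra.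
by field.
Qed.

Lemma weight_gt0 (R : realType) (beta t : R) : 0 < t < 1 -> 0 < weight beta t.
Proof. by move=> /andP[t0 t1]; rewrite mulr_gt0// powR_gt0// subr_gt0. Qed.

(** Were the moment zero, the weight would vanish almost everywhere, and the open unit interval, on
    which it is positive, would lie in a null set. *)
Lemma moment0_gt0 (R : realType) (beta : R) : -1 < beta -> 0 < moment beta 0.
Proof.
move=> b1; have iw := integrable_weightX 0 b1.
have w0 (t : R) : 0 <= weight beta t * t ^+ 0.
  by rewrite expr0 mulr1 mulr_ge0 ?powR_ge0.
rewrite lt_neqAle Rintegral_ge0 ?andbT//; apply/eqP => m0.
have mw := measurable_int _ iw.
have : (\int[lebesgue_measure]_(t in `[0%R, 1%R])
    `|(weight beta t * t ^+ 0)%:E|)%E = 0%E.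
  rewrite -[RHS]/(0%R%:E) [X in X%:E]m0 /moment /Rintegral fineK; last first.
    exact: integrable_fin_num.
  by apply: eq_integral => t _ /=; rewrite ger0_norm.
move/(ae_eq_integral_abs _ _ mw).1 => [//|N [mN N0 sub]].
have m1 : lebesgue_measure (`]0%R, 1%R[%classic : set R) = 1%:E.
  by rewrite lebesgue_measure_itv/= lte_fin ltr01 -EFinB subr0.
suff : (1%:E <= (0 : \bar R))%E by rewrite lee_fin ler10.
rewrite -m1 -N0; apply: le_measure; rewrite ?inE//.
move=> t /=; rewrite in_itv/= => t01; apply: sub => /= /(_ _)/eqP.
rewrite in_itv/= expr0 mulr1 eqe gt_eqF ?weight_gt0// => H.
by case/andP: t01 => t0 t1; have := H; rewrite !ltW//= => /(_ isT).
Qed.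

(** The beta integral has integrand [t w_beta(t)], so it is the moment of order 1, half of that of
    order 0. *)
Lemma nuE (R : realType) (beta : R) : -1 < beta ->
  nu beta = moment beta 0 / (6%:R * (2%:R * beta + 3%:R)).
Proof.
move=> b1; rewrite /nu (_ : euler_beta _ _ = moment beta 1).
  by rewrite moment1E//; field; apply/eqP; lra.
apply: eq_Rintegral => t; rewrite inE/= in_itv/= => /andP[t0 t1].
rewrite addrK (_ : beta + 2 - 1 = beta + 1); last by ring.
have b0 : 0 < beta + 1 by lra.
by rewrite -(mulr_powRB1 t0 b0) addrK /weight; ring.
Qed.

Lemma nu_gt0 (R : realType) (beta : R) : -1 < beta -> 0 < nu beta.
Proof.
move=> b1; rewrite nuE// divr_gt0 ?moment0_gt0// mulr_gt0//; lra.
Qed.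

Lemma Rintegral_quadratic (R : realType) (a b c : R) :
  \int[lebesgue_measure]_(t in `[0%R, 1%R]) (a + b * t + c * t ^+ 2) =
  a + b / 2%:R + c / 3%:R.
Proof.
(* this is the case beta = 0 of the weighted integrals *)
have m0 : moment (0 : R) 0 = 1.
  rewrite /moment; under eq_Rintegral do rewrite /weight !powRr0 expr0 !mulr1.
  rewrite Rintegral_cst// mul1r; apply: (congr1 fine (y := 1%:E)).
  have : lebesgue_measure (`[0%R, 1%R]%classic : set R) = 1%:E; last exact.
  by rewrite lebesgue_measure_itv/= lte_fin ltr01 -EFinB subr0.
have N10 : -1 < 0 :> R by rewrite ltrN10.
transitivity (\int[lebesgue_measure]_(t in `[0%R, 1%R])
    (weight 0 t * (a + b * t + c * t ^+ 2))).
  by apply: eq_Rintegral => t _; rewrite /weight !powRr0 !mul1r.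
by rewrite Rintegral_weight_quadratic// moment1E// moment2E// m0; field.
Qed.

(** * Degrees of freedom in barycentric coordinates *)

(** Index arithmetic modulo 3 is stated relative to an arbitrary [j], so that later computations
    treat all vertices at once. *)
Lemma I3D (j : 'I_3) :
  (j + 1 + 1 = j + 2%:R) * (j + 1 + 2%:R = j) * (j + 2%:R + 1 = j) *
  (j + 2%:R + 2%:R = j + 1).
Proof. by case: j => [[|[|[|]]]] // ?; do !split; exact/val_inj. Qed.

Lemma I3_neq (j : 'I_3) :
  (j == j + 1 = false) * (j == j + 2%:R = false) *
  (j + 1 == j = false) * (j + 2%:R == j = false) *
  (j + 1 == j + 2%:R = false) * (j + 2%:R == j + 1 = false).
Proof. by case: j => [[|[|[|]]]]. Qed.

Lemma I3P (j : 'I_3) (P : 'I_3 -> Prop) :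
  P j -> P (j + 1) -> P (j + 2%:R) -> forall k, P k.
Proof.
move=> P0 P1 P2 k.
have : [|| k == j, k == j + 1 | k == j + 2%:R].
  by case: j k {P0 P1 P2} => [[|[|[|]]]] // ? [[|[|[|]]]].
by case/or3P=> /eqP ->.
Qed.

Lemma big_I3 (V : nmodType) (F : 'I_3 -> V) (j : 'I_3) :
  \sum_k F k = F j + F (j + 1) + F (j + 2%:R).
Proof.
rewrite (bigD1 j)// (bigD1 (j + 1)) ?I3_neq// (bigD1 (j + 2%:R)) ?I3_neq//.
rewrite big1; first by rewrite /= addr0 addrA.
by apply: (I3P (j := j)); rewrite ?eqxx ?andbF.
Qed.

Lemma big_I3_neq (V : nmodType) (F : 'I_3 -> V) (j : 'I_3) :
  \sum_(k < 3 | k != j) F k = F (j + 1) + F (j + 2%:R).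
Proof.
rewrite (bigD1 (j + 1)) ?I3_neq// (bigD1 (j + 2%:R)) ?I3_neq//.
rewrite big1; first by rewrite /= addr0.
by apply: (I3P (j := j)); rewrite ?eqxx ?andbF.
Qed.

Section barycentric_coordinates.
Context (R : realType) (v : 'I_3 -> 'rV[R]_2) (lam : 'I_3 -> 'rV[R]_2 -> R).
Hypothesis hlam : barycentric v lam.

(** Affine maps preserve combinations with coefficients of sum 1: the constant [c] is distributed as
    [\sum_j a j * c]. *)
Lemma barycentric_sum (a : 'I_3 -> R) i : \sum_j a j = 1 ->
  lam i (\sum_j a j *: v j) = a i.
Proof.
move=> a1; have [[l [c lE]] lamv] := hlam i.
rewrite lE linear_sum/= -[c]mul1r -a1 mulr_suml -big_split/=.
transitivity (\sum_j a j * lam i (v j)).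
  by apply: eq_bigr => j _; rewrite linearZ/= lE mulrDr.
rewrite (bigD1 i)//= lamv eqxx mulr1 big1 ?addr0// => j ji.
by rewrite lamv eq_sym (negbTE ji) mulr0.
Qed.

Lemma triangle_barycentric x : triangle v x ->
  \sum_i lam i x = 1 /\ x = \sum_i lam i x *: v i.
Proof.
move=> [a [_ a1 ->]].
split; first by under eq_bigr do rewrite barycentric_sum//.
by under [in RHS]eq_bigr do rewrite barycentric_sum//.
Qed.

(** Used with one zero coefficient for the points of an edge, and with two equal ones for the points
    joining a vertex to the centroid. *)
Lemma triangle_comb3 (j : 'I_3) (a b c : R) :
    0 <= a -> 0 <= b -> 0 <= c -> a + b + c = 1 ->
  let x := a *: v j + b *: v (j + 1) + c *: v (j + 2%:R) in
  [/\ triangle v x, lam j x = a, lam (j + 1) x = b & lam (j + 2%:R) x = c].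
Proof.
move=> a0 b0 c0 abc x.
pose w k := if k == j then a else if k == j + 1 then b else c.
have w1 : \sum_k w k = 1 by rewrite (big_I3 _ j) /w !eqxx !I3_neq.
have xE : x = \sum_k w k *: v k by rewrite (big_I3 _ j) /w !eqxx !I3_neq.
split; [|by rewrite xE barycentric_sum// /w ?eqxx ?I3_neq..].
exists w; split => //; apply: (I3P (j := j)); rewrite /w ?eqxx ?I3_neq//.
Qed.

(** On the edge, of coordinates [(0, t, 1 - t)], [varphi] restricts to 0, [3 t^2 - 2 t] and
    [3 t^2 - 4 t + 1], all of mean zero; the only nonzero [phi] is [6 t (1 - t)], of mean 1. *)
Lemma ICR_spec (f : 'rV[R]_2 -> R) (a b : 'I_3 -> R) (j : 'I_3) :
    (forall x, triangle v x ->
      f x = \sum_i (a i * varphi lam i x + b i * phi lam i x)) ->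
  ICR v j f = b j.
Proof.
move=> fE; rewrite /ICR.
pose A := a (j + 1); pose B := a (j + 2%:R); pose C := b j.
transitivity (\int[lebesgue_measure]_(t in `[0%R, 1%R])
  (B + (-2 * A - 4 * B + 6 * C) * t + (3 * A + 3 * B - 6 * C) * t ^+ 2)).
  apply: eq_Rintegral => t; rewrite inE/= in_itv/= => /andP[t0 t1].
  have t1' : 0 <= 1 - t by rewrite subr_ge0.
  have := @triangle_comb3 j 0 t (1 - t) (lexx 0) t0 t1'.
  rewrite add0r scale0r add0r subrKC => /(_ erefl)[xT l0 l1 l2].
  rewrite fE// (big_I3 _ j) /varphi /phi !I3D l0 l1 l2 /A /B /C.
  ring.
by rewrite Rintegral_quadratic /A /B /C; field.
Qed.

Lemma Genr_spec (beta : R) (f : 'rV[R]_2 -> R) (a b : 'I_3 -> R) (j : 'I_3) :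
    -1 < beta ->
    (forall x, triangle v x ->
      f x = \sum_i (a i * varphi lam i x + b i * phi lam i x)) ->
  Genr v beta j f = nu beta *
    (2%:R * a j - sigma beta * (a (j + 1) + a (j + 2%:R))
     + 2%:R * (beta + 2%:R) * b j
     + (8%:R * beta + 10%:R) * (b (j + 1) + b (j + 2%:R))).
Proof.
move=> b1 fE; rewrite /Genr.
pose A := a j; pose B := a (j + 1) + a (j + 2%:R).
pose C := b j; pose D := b (j + 1) + b (j + 2%:R).
(* At coordinates [((1 + 2 t)/3, (1 - t)/3, (1 - t)/3)], [varphi] takes the values [(4 t^2 - 1)/3]
   at [j] and [(t^2 - 1)/3] elsewhere; [phi] takes [2 (1 - t)^2 / 3] and
   [2 (1 + 2 t)(1 - t) / 3]. *)
transitivity (\int[lebesgue_measure]_(t in `[0%R, 1%R])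
  (weight beta t * ((- A - B + 2 * C + 2 * D) / 3 +
    (- 4 * C + 2 * D) / 3 * t + (4 * A + B + 2 * C - 4 * D) / 3 * t ^+ 2))).
  apply: eq_Rintegral => t; rewrite inE/= in_itv/= => /andP[t0 t1].
  congr (_ * _).
  have a0 : 0 <= (1 + 2 * t) / 3 by lra.
  have b0 : 0 <= (1 - t) / 3 by lra.
  have ab1 : (1 + 2 * t) / 3 + (1 - t) / 3 + (1 - t) / 3 = 1 by field.
  have := triangle_comb3 j a0 b0 b0 ab1.
  have -> : ((1 + 2 * t) / 3) *: v j + ((1 - t) / 3) *: v (j + 1) +
      ((1 - t) / 3) *: v (j + 2%:R) = t *: v j + (1 - t) *: mstar v.
    by rewrite /mstar (big_I3 _ j); apply/rowP => k; rewrite !mxE; field.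
  move=> [xT l0 l1 l2].
  rewrite fE// (big_I3 _ j) /varphi /phi !I3D l0 l1 l2 /A /B /C /D.
  by field.
rewrite Rintegral_weight_quadratic// moment1E// moment2E// nuE//.
rewrite /sigma /A /B /C /D; field; apply/eqP; lra.
Qed.

End barycentric_coordinates.

(** * Quadratic polynomials and the nodal basis *)

Section quadratic_polynomials.
Context (R : realType) (v : 'I_3 -> 'rV[R]_2) (lam : 'I_3 -> 'rV[R]_2 -> R).
Hypothesis hlam : barycentric v lam.
Local Notation T := (triangle v).

Lemma poly2_on_eq (K : set 'rV[R]_2) (f g : 'rV[R]_2 -> R) :
  (forall x, K x -> f x = g x) -> poly2_on K g -> poly2_on K f.
Proof. by move=> fg [p sp pE]; exists p => // x Kx; rewrite fg// pE. Qed.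

Lemma poly2_onD (K : set 'rV[R]_2) (f g : 'rV[R]_2 -> R) :
  poly2_on K f -> poly2_on K g -> poly2_on K (fun x => f x + g x).
Proof.
move=> [p sp pE] [q sq qE]; exists (p + q).
  by rewrite (leq_trans (mpoly.msizeD_le _ _))// geq_max sp.
by move=> x Kx; rewrite mpoly.mevalD pE// qE.
Qed.

Lemma poly2_onZ (K : set 'rV[R]_2) (c : R) (f : 'rV[R]_2 -> R) :
  poly2_on K f -> poly2_on K (fun x => c * f x).
Proof.
move=> [p sp pE]; exists (c *: p).
  exact: leq_trans (mpoly.msizeZ_le _ _) sp.
by move=> x Kx; rewrite mpoly.mevalZ pE.
Qed.

Lemma affine_mpoly (f : 'rV[R]_2 -> R) : affine_function f ->
  exists2 p : mpoly.mpoly 2 R, (mpoly.msize p <= 2)%N &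
    forall x, f x = mpoly.meval (fun i => x 0 i) p.
Proof.
move=> [l [c fE]].
exists (\sum_i l (delta_mx 0 i) *: mpoly.mpolyX R (mpoly.mnm1 i) + mpoly.mpolyC 2 c).
  rewrite (leq_trans (mpoly.msizeD_le _ _))// geq_max mpoly.msizeC.
  rewrite (leq_trans (leq_b1 _))// andbT.
  rewrite (leq_trans (mpoly.msize_sum _ _ _))//.
  apply/bigmax_leqP => i _.
  by rewrite (leq_trans (mpoly.msizeZ_le _ _))// mpoly.msizeX mpoly.mdeg1.
move=> x; rewrite mpoly.mevalD mpoly.mevalC fE {1}(row_sum_delta x).
rewrite linear_sum raddf_sum; congr (_ + _); apply: eq_bigr => i _.
by rewrite linearZ/= mpoly.mevalZ mpoly.mevalXU mulrC.
Qed.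

Lemma poly2_on_affineM (K : set 'rV[R]_2) (f g : 'rV[R]_2 -> R) :
  affine_function f -> affine_function g -> poly2_on K (fun x => f x * g x).
Proof.
move=> /affine_mpoly[p sp pE] /affine_mpoly[q sq qE].
exists (p * q); last by move=> x _; rewrite mpoly.mevalM pE qE.
(* The size of a product is the sum of the sizes minus 1 only for nonzero factors; here it gives
   [2 + 2 - 1 = 3]. *)
have [->|p0] := eqVneq p 0; first by rewrite mul0r mpoly.msize0.
have [->|q0] := eqVneq q 0; first by rewrite mulr0 mpoly.msize0.
by rewrite mpoly.msizeM// -subn1 leq_subLR; exact: leq_add sp sq.
Qed.

Lemma poly2_on_varphi i : poly2_on T (varphi lam i).
Proof.
have ilam k : affine_function (lam k) by have [] := hlam k.
(* Replacing 1 by the sum of the coordinates makes [varphi] homogeneous: [lam_i (lam_i - 2 lam_(i+1)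
   - 2 lam_(i+2))]. *)
apply: (@poly2_on_eq _ _ (fun x => lam i x * lam i x
    + -2%:R * (lam i x * lam (i + 1) x) + -2%:R * (lam i x * lam (i + 2%:R) x))).
  move=> x /(triangle_barycentric hlam)[+ _]; rewrite (big_I3 _ i) /varphi => s.
  by rewrite -[X in _ * (X - _ - _)]s; ring.
apply: poly2_onD; [apply: poly2_onD|]; [|apply: poly2_onZ..]; exact: poly2_on_affineM.
Qed.

Lemma poly2_on_phi i : poly2_on T (phi lam i).
Proof.
have ilam k : affine_function (lam k) by have [] := hlam k.
apply: (@poly2_on_eq _ _ (fun x => 6%:R * (lam (i + 1) x * lam (i + 2%:R) x))).
  by move=> x _; rewrite /phi mulrA.
by apply: poly2_onZ; exact: poly2_on_affineM.
Qed.

Definition bubble_span : set ('rV[R]_2 -> R) :=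
  [set f | exists a b : 'I_3 -> R, forall x, T x ->
    f x = \sum_i (a i * varphi lam i x + b i * phi lam i x)].

(** Since the coordinates sum to 1 on the triangle, these homogeneous forms are the affine functions
    there, constants included. *)
Definition linear_form : set ('rV[R]_2 -> R) :=
  [set f | exists a : 'I_3 -> R, forall x, T x -> f x = \sum_i a i * lam i x].

(** The witnesses come from [lam_i^2 = varphi_i + (phi_(i+1) + phi_(i+2)) / 3] and
    [lam_(i+1) lam_(i+2) = phi_i / 6]. *)
Lemma bubble_spanM (f g : 'rV[R]_2 -> R) :
  linear_form f -> linear_form g -> bubble_span (fun x => f x * g x).
Proof.
move=> [a fE] [b gE].
exists (fun i => a i * b i); exists (fun i =>
  (a (i + 1) * b (i + 1) + a (i + 2%:R) * b (i + 2%:R)) / 3%:R +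
  (a (i + 1) * b (i + 2%:R) + a (i + 2%:R) * b (i + 1)) / 6%:R) => x Tx.
rewrite fE// gE// !(big_I3 _ 0) /varphi /phi !I3D.
have [] := triangle_barycentric hlam Tx; rewrite (big_I3 _ 0) => s _.
have -> : lam 0 x = 1 - lam (0 + 1) x - lam (0 + 2%:R) x by rewrite -s; ring.
by field.
Qed.

Lemma linear_form1 : linear_form (fun=> 1).
Proof.
exists (fun=> 1) => x /(triangle_barycentric hlam)[s _].
by rewrite -[LHS]s; apply: eq_bigr => i _; rewrite mul1r.
Qed.

Lemma linear_form_coord k : linear_form (fun x => x 0 k).
Proof.
exists (fun i => v i 0 k) => x /(triangle_barycentric hlam)[_ xE].
by rewrite {1}xE summxE; apply: eq_bigr => i _; rewrite mxE mulrC.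
Qed.

Lemma bubble_spanD (f g : 'rV[R]_2 -> R) :
  bubble_span f -> bubble_span g -> bubble_span (fun x => f x + g x).
Proof.
move=> [a [b fE]] [a' [b' gE]].
exists (fun i => a i + a' i), (fun i => b i + b' i) => x Tx.
rewrite fE// gE// -big_split; apply: eq_bigr => i _ /=; ring.
Qed.

Lemma bubble_spanZ (c : R) (f : 'rV[R]_2 -> R) :
  bubble_span f -> bubble_span (fun x => c * f x).
Proof.
move=> [a [b fE]]; exists (fun i => c * a i), (fun i => c * b i) => x Tx.
rewrite fE// mulr_sumr; apply: eq_bigr => i _; ring.
Qed.

Lemma bubble_span_monomial (m n : nat) : (m + n <= 2)%N ->
  bubble_span (fun x => x 0 0 ^+ m * x 0 1 ^+ n).
Proof.
have L1 := linear_form1; have LX := linear_form_coord.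
move: m n => [|[|[|m]]] [|[|[|n]]] // _.
- exact: (bubble_spanM L1 L1).
- exact: (bubble_spanM L1 (LX 1)).
- have := bubble_spanM (LX 1) (LX 1); congr (bubble_span _).
  by apply/funext => x; rewrite expr0 mul1r.
- exact: (bubble_spanM (LX 0) L1).
- exact: (bubble_spanM (LX 0) (LX 1)).
- have := bubble_spanM (LX 0) (LX 0); congr (bubble_span _).
  by apply/funext => x; rewrite expr0 mulr1.
Qed.

Lemma poly2_on_bubble_span (f : 'rV[R]_2 -> R) : poly2_on T f -> bubble_span f.
Proof.
move=> [p sp fE].
suff [a [b pE]] : bubble_span (fun x => mpoly.meval (fun i => x 0 i) p).
  by exists a, b => x Tx; rewrite fE// pE.
under eq_fun do rewrite mpoly.mevalE.
have bubble_span0 : bubble_span (fun=> 0).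
  exists (fun=> 0), (fun=> 0) => x _; rewrite big1// => i _.
  by rewrite !mul0r addr0.
have : all (fun m => (mpoly.mdeg m <= 2)%N) (mpoly.msupp p).
  apply/allP => m /mpoly.msize_mdeg_lt mp.
  by rewrite -ltnS (leq_trans mp).
(* The induction runs over the list of monomials; the coefficients remain those of [p]. *)
elim: (mpoly.msupp p) => [_|m s ih /= /andP[m2 /ih{}ih]].
  by under eq_fun do rewrite big_nil.
under eq_fun do rewrite big_cons.
apply: bubble_spanD => //; apply: bubble_spanZ.
under eq_fun do rewrite big_ord_recl big_ord1.
move: m2; rewrite mpoly.mdegE big_ord_recl big_ord1.
rewrite (_ : lift ord0 ord0 = 1); last exact/val_inj.
by rewrite (_ : ord0 = 0)//; exact: bubble_span_monomial.
Qed.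

End quadratic_polynomials.

(** * Duality relations for the explicit family *)

Section nodal_basis.
Context (R : realType) (v : 'I_3 -> 'rV[R]_2) (lam : 'I_3 -> 'rV[R]_2 -> R).
Hypothesis hlam : barycentric v lam.
Context (beta : R).
Hypothesis hbeta : -1 < beta.
Local Notation T := (triangle v).

(** The coefficients [r], [m] solve [2 r - 2 sigma m + 2 (beta + 2) = 0] and
    [2 m - sigma (r + m) + 8 beta + 10 = 0], which express that the enriched functionals vanish. *)
Definition nodal_tau (i : 'I_3) (x : 'rV[R]_2) : R :=
  rbeta beta * varphi lam i x
  + mbeta beta * (\sum_(k < 3 | k != i) varphi lam k x) + phi lam i x.

(** The coefficients form the inverse of the matrix with [2 nu] on the diagonal and [- sigma nu] off
    it. Up to the factor [nu], its eigenvalues are [2 + sigma = 3 (beta + 2)], twice, and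
    [2 - 2 sigma = -6 (beta + 1)]; the product of these two values is [- Lbeta]. *)
Definition nodal_rho (i : 'I_3) (x : 'rV[R]_2) : R :=
  (nu beta * Lbeta beta)^-1 *
  ((sigma beta - 2%:R) * varphi lam i x
   - sigma beta * (\sum_(k < 3 | k != i) varphi lam k x)).

Let b1 : beta + 1 != 0. Proof. by move: hbeta => h; rewrite gt_eqF//; lra. Qed.
Let b2 : beta + 2%:R != 0. Proof. by move: hbeta => h; rewrite gt_eqF//; lra. Qed.
Let nu0 : nu beta != 0. Proof. by rewrite gt_eqF// nu_gt0. Qed.

(** Change of basis to [varphi] and [phi]: only [nodal_tau] contains [phi], so the coefficients of
    [phi] are exactly [p]. *)
Lemma nodal_combE (p q : 'I_3 -> R) (x : 'rV[R]_2) :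
  \sum_i (p i * nodal_tau i x + q i * nodal_rho i x) =
  \sum_i ((rbeta beta * p i + mbeta beta * (p (i + 1) + p (i + 2%:R))
           + (nu beta * Lbeta beta)^-1 * ((sigma beta - 2%:R) * q i
             - sigma beta * (q (i + 1) + q (i + 2%:R)))) * varphi lam i x
          + p i * phi lam i x).
Proof.
by rewrite !(big_I3 _ 0) /nodal_tau /nodal_rho !big_I3_neq !I3D; ring.
Qed.

(** Reading the coefficients off the functionals gives duality, independence and uniqueness at
    once. *)
Lemma dof_nodal_comb (f : 'rV[R]_2 -> R) (p q : 'I_3 -> R) :
    (forall x, T x -> f x = \sum_i (p i * nodal_tau i x + q i * nodal_rho i x)) ->
  forall j, ICR v j f = p j /\ Genr v beta j f = q j.
Proof.
move=> fE j.
have {}fE x (Tx : T x) := etrans (fE x Tx) (nodal_combE p q x).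
split; first by rewrite (ICR_spec hlam j fE).
rewrite (Genr_spec hlam j hbeta fE) !I3D /rbeta /mbeta /Lbeta /sigma.
by field; rewrite b1 b2 nu0.
Qed.

Lemma poly2_on_nodal_tau i : poly2_on T (nodal_tau i).
Proof.
have P := poly2_on_varphi hlam.
apply: poly2_onD; last exact: poly2_on_phi.
under eq_fun do rewrite big_I3_neq.
by apply: poly2_onD; apply: poly2_onZ => //; exact: poly2_onD.
Qed.

Lemma poly2_on_nodal_rho i : poly2_on T (nodal_rho i).
Proof.
have P := poly2_on_varphi hlam.
apply: poly2_onZ; under eq_fun do rewrite big_I3_neq -mulNr.
by apply: poly2_onD; apply: poly2_onZ => //; exact: poly2_onD.
Qed.

Lemma poly2_on_nodal_comb (f : 'rV[R]_2 -> R) : poly2_on T f ->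
  exists p q : 'I_3 -> R, forall x, T x ->
    f x = \sum_i (p i * nodal_tau i x + q i * nodal_rho i x).
Proof.
move=> /(poly2_on_bubble_span hlam)[a [b fE]].
(* By [nodal_combE], [p] must be the vector of [phi] coefficients; by [dof_nodal_comb], [q] must
   consist of the enriched moments of [f]. *)
exists b, (fun i => Genr v beta i f) => x Tx.
rewrite nodal_combE fE// !(big_I3 _ 0) !(Genr_spec hlam _ hbeta fE) !I3D.
rewrite /rbeta /mbeta /Lbeta /sigma.
by field; rewrite b1 b2 nu0.
Qed.

End nodal_basis.

(** * Characterization of the basis functions *)

Unset Implicit Arguments.

Theorem theorem3p5 (R : realType) (v : 'I_3 -> 'rV[R]_2)
    (hv : nondegenerate_triangle v)
    (lam : 'I_3 -> 'rV[R]_2 -> R) (hlam : barycentric v lam)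
    (beta : R) (hbeta : -1 < beta)
    (tau rho : 'I_3 -> 'rV[R]_2 -> R) :
  basis_functions (E := enriched_element v beta) (pair_family tau rho) <->
  (forall i : 'I_3, forall x, triangle v x ->
     tau i x = rbeta beta * varphi lam i x
               + mbeta beta * (\sum_(k < 3 | k != i) varphi lam k x)
               + phi lam i x /\
     rho i x = (nu beta * Lbeta beta)^-1 *
               ((sigma beta - 2%:R) * varphi lam i x
                - sigma beta * (\sum_(k < 3 | k != i) varphi lam k x))).
Proof.
split.
  move=> [[Pb _ _] dofE] i.
  have tau_dof j : ICR v j (tau i) = (i == j)%:R /\ Genr v beta j (tau i) = 0.
    by split; [exact: (dofE (inl i) (inl j))|exact: (dofE (inl i) (inr j))].
  have rho_dof j : ICR v j (rho i) = 0 /\ Genr v beta j (rho i) = (i == j)%:R.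
    by split; [exact: (dofE (inr i) (inl j))|exact: (dofE (inr i) (inr j))].
  (* The unknown functions are expanded in the explicit family; their prescribed functionals then
     force every coefficient. *)
  have [p [q tauE]] := poly2_on_nodal_comb hlam hbeta (Pb (inl i)).
  have [p' [q' rhoE]] := poly2_on_nodal_comb hlam hbeta (Pb (inr i)).
  move=> x Tx; split.
    rewrite [LHS]tauE// (bigD1 i)//= big1 => [|k ki].
      have [<- <-] := dof_nodal_comb hlam hbeta tauE i.
      by have [-> ->] := tau_dof i; rewrite eqxx mul1r mul0r !addr0.
    have [<- <-] := dof_nodal_comb hlam hbeta tauE k.
    by have [-> ->] := tau_dof k; rewrite eq_sym (negbTE ki) !mul0r addr0.
  rewrite [LHS]rhoE// (bigD1 i)//= big1 => [|k ki].
    have [<- <-] := dof_nodal_comb hlam hbeta rhoE i.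
    by have [-> ->] := rho_dof i; rewrite eqxx mul1r mul0r add0r addr0.
  have [<- <-] := dof_nodal_comb hlam hbeta rhoE k.
  by have [-> ->] := rho_dof k; rewrite eq_sym (negbTE ki) !mul0r addr0.
move=> trE.
have tauE i x (Tx : triangle v x) : tau i x = nodal_tau lam beta i x.
  by have [] := trE i x Tx.
have rhoE i x (Tx : triangle v x) : rho i x = nodal_rho lam beta i x.
  by have [] := trE i x Tx.
have combE (c : 'I_3 + 'I_3 -> R) x (Tx : triangle v x) :
    \sum_s c s * pair_family tau rho s x =
    \sum_i (c (inl i) * nodal_tau lam beta i x + c (inr i) * nodal_rho lam beta i x).
  rewrite big_sumType/= -big_split; apply: eq_bigr => i _ /=.
  by rewrite tauE// rhoE.
(* The functionals recover the coefficients of any expansion on the triangle; independence and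
   duality are instances. *)
have dofE (c : 'I_3 + 'I_3 -> R) (f : 'rV[R]_2 -> R) :
    (forall x, triangle v x -> f x = \sum_s c s * pair_family tau rho s x) ->
    forall s, enriched_dof v beta s f = c s.
  move=> fE; have {}fE x (Tx : triangle v x) := etrans (fE x Tx) (combE c x Tx).
  by case=> j; have [] := dof_nodal_comb hlam hbeta fE j.
split; [split|].
- case=> i.
  + exact: poly2_on_eq (tauE i) (poly2_on_nodal_tau hlam beta i).
  + exact: poly2_on_eq (rhoE i) (poly2_on_nodal_rho hlam beta i).
- move=> c c0 s.
  (* The zero function is expanded twice, with coefficients [c] and with zero coefficients. *)
  transitivity (enriched_dof v beta s (fun=> 0)).
    by apply/esym/dofE => x Tx; rewrite c0.
  apply: (dofE (fun=> 0)) => x _.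
  by rewrite big1// => k _; rewrite mul0r.
- move=> f /(poly2_on_nodal_comb hlam hbeta)[p [q fE]].
  exists (fun s => match s with inl i => p i | inr i => q i end) => x Tx.
  by rewrite fE// combE.
(* Each member of the family is its own expansion, with Kronecker coefficients. *)
- move=> s s'; apply: (dofE (fun k => (s == k)%:R)) => x _.
  rewrite (bigD1 s)//= eqxx mul1r big1 ?addr0// => k ks.
  by rewrite eq_sym (negbTE ks) mul0r.
Qed.
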